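(* Let $K$ be an arbitrary field and let $u,v\in K\langle x,y,z\rangle$ be such that $(u,v)\neq(0,0)$ and all monomials of $u$ and of $v$ (i.e. all monomials occurring with nonzero coefficient) depend on both $x$ and $y$. Then the $z$-endomorphism $$\varphi=(x+u(x,y,z),\ y+v(x,y,z))$$ is not an automorphism of $K\langle x,y,z\rangle$.
   Context: $K\langle x,y,z\rangle$ is the free associative (unital) $K$-algebra freely generated by $x,y,z$. A $z$-endomorphism is a $K$-algebra endomorphism $\varphi$ of $K\langle x,y,z\rangle$ with $\varphi(z)=z$; it is written $\varphi=(f,g)$ with $f=\varphi(x)$, $g=\varphi(y)$. A monomial depends on both $x$ and $y$ if each of $x$ and $y$ occurs in it at least once. *)

(* Defs.v *)
From HB Require Import structures.
From mathcomp Require Import all_boot all_algebra finmap.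
From mathcomp.multinomials Require Export monalg.

Set Implicit Arguments.
Unset Strict Implicit.
Unset Printing Implicit Defensive.

Import GRing.Theory.
Local Open Scope ring_scope.

(* The free associative unital algebra K<x,y,z>: the monoid algebra over K of
   the free monoid of words in three letters, numbered 0 (x), 1 (y), 2 (z). *)
Notation freeAlg3 K := {malg K[{fmonom 'I_3}]}.

Definition ix : 'I_3 := inord 0.
Definition iy : 'I_3 := inord 1.
Definition iz : 'I_3 := inord 2.

Section FreeAlgebra.
Context {K : fieldType}.
Local Notation A := (freeAlg3 K).

Definition gen (i : 'I_3) : A := << fmu i >>.
Definition gx : A := gen ix.
Definition gy : A := gen iy.
Definition gz : A := gen iz.

Definition depends_on_xy (m : {fmonom 'I_3}) : bool :=
  (ix \in (m : seq 'I_3)) && (iy \in (m : seq 'I_3)).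

Definition zimages (f g : A) (i : 'I_3) : A :=
  if i == ix then f else if i == iy then g else gz.

(* The value of a word is the product of the images of its letters, in order. *)
Definition zword (f g : A) (m : {fmonom 'I_3}) : A :=
  \prod_(i <- (m : seq 'I_3)) zimages f g i.

Lemma zword_mmorphism f g : mmorphism (zword f g).
Proof.
split=> [m1 m2|]; first by rewrite /zword fmM big_cat.
by rewrite /zword fm1 big_nil.
Qed.

HB.instance Definition _ f g :=
  isMultiplicative.Build {fmonom 'I_3} A (zword f g) (zword_mmorphism f g).

(* The z-endomorphism (f, g): x |-> f, y |-> g, z |-> z. *)
Definition zendo (f g : A) : A -> A :=
  mmap (@malgC {fmonom 'I_3} K) (zword f g).

Lemma malgC_comm (c : K) (a : A) : GRing.comm (c%:MP : A) a.
Proof.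
rewrite /GRing.comm !malgM_def fgmulUg fgmulgU.
by apply: eq_bigr => m _; rewrite mulrC mul1m mulm1.
Qed.

Lemma zendo_is_additive f g : additive (zendo f g).
Proof. exact: mmap_is_additive. Qed.

Lemma zendo_is_multiplicative f g : multiplicative (zendo f g).
Proof.
by apply: commr_mmap_is_multiplicative => a m m'; apply: malgC_comm.
Qed.

Lemma zendo_is_scalable f g : scalable (zendo f g).
Proof. by move=> c a; rewrite /zendo mmapZ mul_malgC. Qed.

HB.instance Definition _ f g :=
  GRing.isAdditive.Build A A (zendo f g) (zendo_is_additive f g).
HB.instance Definition _ f g :=
  GRing.isMultiplicative.Build A A (zendo f g) (zendo_is_multiplicative f g).
HB.instance Definition _ f g :=
  GRing.isScalable.Build K A A *:%R (zendo f g) (zendo_is_scalable f g).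

Lemma zendo_gen f g i : zendo f g (gen i) = zimages f g i.
Proof. by rewrite /zendo mmapU /zword fmU big_seq1 [X in X * _]rmorph1 mul1r. Qed.

Lemma zendo_x f g : zendo f g gx = f.
Proof. by rewrite zendo_gen /zimages eqxx. Qed.

Lemma zendo_y f g : zendo f g gy = g.
Proof. by rewrite zendo_gen /zimages eqxx -val_eqE /= !inordK. Qed.

Lemma zendo_z f g : zendo f g gz = gz.
Proof. by rewrite zendo_gen /zimages -!val_eqE /= !inordK. Qed.

Lemma word_gen (m : {fmonom 'I_3}) :
  << m >> = \prod_(i <- (m : seq 'I_3)) gen i :> A.
Proof.
case: m => s; rewrite /=; elim: s => [|i s IH].
  by rewrite big_nil -fmoneE.
rewrite big_cons -IH /gen malgME !msuppU1 !big_seq_fset1 !mcoeffUU mulr1.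
by congr (<< _ >>); apply/eqP; rewrite fmP fmM fmU.
Qed.

Lemma zendo_unique f g (phi : {lrmorphism A -> A}) :
  phi gx = f -> phi gy = g -> phi gz = gz -> phi =1 zendo f g.
Proof.
move=> px py pz.
have pgen i : phi (gen i) = zendo f g (gen i).
  have -> : i = [tuple ix; iy; iz]`_i.
    by case: i => -[|[|[|]]] //= h; apply/val_inj; rewrite /= inordK.
  by case: i => -[|[|[|]]] //= h; rewrite ?px ?py ?pz ?zendo_x ?zendo_y ?zendo_z.
move=> a; rewrite [a]monalgE !raddf_sum; apply: eq_bigr => m _.
have -> : << a@_m *g m >> = a@_m *: << m >> :> A.
  by apply/malgP=> k; rewrite mcoeffZ !mcoeffU mulr_natr.
rewrite /= !linearZ /= word_gen !rmorph_prod; congr (_ *: _).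
by apply: eq_bigr => i _; apply: pgen.
Qed.

Definition is_automorphism (phi : {lrmorphism A -> A}) : Prop := bijective phi.

End FreeAlgebra.

(* Main.v *)
(* Order words by a weight [a * deg_x + b * deg_y], then by length, then
   lexicographically. If the leading words [w1], [w2] of [x + u], [y + v] have
   linearly independent (deg_x, deg_y), then {w1, w2, z} is a code (defect
   theorem), so images of distinct words have distinct leading words and cannot
   cancel. Since [phi] preserves the coefficients of one-letter words, a preimage
   of [x] contains the word [x]; comparing leading words then forces [w1 = x],
   and likewise [w2 = y]. On the other hand (a, b) can be chosen as a normal
   direction of the Newton polygons for which [x] and [y] have maximal weight,
   some longer word of [u] or [v] ties with it, and the independence holds;
   for this order [w1 = x] and [w2 = y] is impossible. *)
Require Import Defs.
From mathcomp Require Import all_boot all_order all_algebra finmap.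
From mathcomp Require Import zify ring.

Set Implicit Arguments.
Unset Strict Implicit.
Unset Printing Implicit Defensive.

Import Order.TTheory GRing.Theory Num.Theory.
Local Open Scope ring_scope.

(** * Injective word substitutions and the defect theorem *)

Section Codes.

Definition subst_word (S T : Type) (W : S -> seq T) (s : seq S) : seq T :=
  flatten (map W s).

Lemma subst_word_comp (R S T : Type) (V : R -> seq S) (W : S -> seq T) s :
  subst_word (fun c => subst_word W (V c)) s = subst_word W (subst_word V s).
Proof.
by rewrite /subst_word; elim: s => //= c s ->; rewrite map_cat flatten_cat.
Qed.

Lemma cat_eq_prefix (T : eqType) (u v s t : seq T) :
  u ++ s = v ++ t -> prefix u v || prefix v u.
Proof.
elim: u v => [|a u IH] [|b v] //= [-> /IH].
by rewrite eqxx.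
Qed.

(** Base case of the reduction below: two blocks that start the same word are prefix-comparable, so
    decoding from the left is unambiguous. *)
Lemma prefix_code (T U : eqType) (W : T -> seq U) :
  (forall c, W c != [::]) ->
  (forall c d, c != d -> ~~ prefix (W c) (W d)) ->
  injective (subst_word W).
Proof.
move=> W0 Wpre; elim=> [|c s IH] [|d t] //=; rewrite /subst_word /=.
- by case: (W d) (W0 d).
- by case: (W c) (W0 c).
- have [<-|cd] := eqVneq c d; last first.
    move/cat_eq_prefix; case/orP => P; first by rewrite (negPf (Wpre _ _ cd)) in P.
    by rewrite eq_sym in cd; rewrite (negPf (Wpre _ _ cd)) in P.
  by move/eqP; rewrite eqseq_cat // eqxx /= => /eqP /IH ->.
Qed.

Definition insert_before (T : eqType) (c d e : T) : seq T :=
  if e == d then [:: c; d] else [:: e].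

(** No image begins with [d], so the letter after a [c] tells whether that [c] was inserted. *)
Lemma insert_before_inj (T : eqType) (c d : T) :
  c != d -> injective (subst_word (insert_before c d)).
Proof.
move=> cd.
have hd s : ohead (subst_word (insert_before c d) s) != Some d.
  case: s => // e s; rewrite /subst_word /= /insert_before.
  by case: (eqVneq e d) => [_|ed] /=; [move: cd | move: ed]; apply: contraNneq => -[->].
elim=> [|e s IH] [|e' t] //=; rewrite /subst_word /= /insert_before.
- by case: ifP.
- by case: ifP.
- have [->|ed] := eqVneq e d; have [->|e'd] := eqVneq e' d => //=.
  + by case=> /IH ->.
  + by case=> _ E; have := hd t; rewrite /subst_word /insert_before -E /= eqxx.
  + by case=> _ E; have := hd s; rewrite /subst_word /insert_before E /= eqxx.
  + by case=> -> /IH ->.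
Qed.

(* Nielsen-type reduction: if [W d = W c ++ r], then replacing [W d] by [r]
   preserves independence and precomposes [subst_word] with the injection that
   inserts [c] before each [d]. *)
Lemma independent_code (T : finType) (U : eqType) (W : T -> seq U) :
  (forall k : T -> int,
     (forall j, \sum_c k c * (count_mem j (W c))%:Z = 0) -> forall c, k c = 0) ->
  injective (subst_word W).
Proof.
have [n] := ubnP (\sum_c size (W c))%N.
elim: n W => // n IH W ltn indep.
(* An empty [W c] would make the indicator of [c] a nontrivial relation. *)
have W0 c : W c != [::].
  apply/eqP => Wc; have := indep (fun e => (e == c)%:R) _ c.
  rewrite eqxx => /(_ _)/eqP; rewrite oner_eq0 => /(_ _)/notF; apply => j.
  by apply: big1 => e _; case: eqVneq => [->|]; rewrite ?Wc ?mulr0 ?mul0r.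
have [/existsP[c /existsP[d /andP[cd /prefixP[r Wd]]]]|nopre] :=
  boolP [exists c, exists d, (c != d) && prefix (W c) (W d)]; last first.
  apply: prefix_code => // c d cd; apply: contra nopre => P.
  by apply/existsP; exists c; apply/existsP; exists d; rewrite cd.
pose W' e := if e == d then r else W e.
have W'd : W' d = r by rewrite /W' eqxx.
have W'n e : e != d -> W' e = W e by rewrite /W' => /negPf ->.
have inj' : injective (subst_word W').
  apply: IH => [|k' k'0].
    rewrite (bigD1 d) //= in ltn; rewrite (bigD1 d) //= W'd.
    rewrite (eq_bigr (fun e => size (W e))) => [|e /W'n ->//].
    move: ltn; rewrite Wd size_cat; have := W0 c; rewrite -size_eq0; lia.
  (* The letter counts of [r] are those of [W d] minus those of [W c], so a relation [k'] for [W']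
     becomes one for [W] once [k' d] is subtracted from the coefficient of [c]. *)
  pose k e := k' e - (e == c)%:R * k' d.
  have k0 : forall e, k e = 0.
    apply: indep => j; rewrite -[RHS](k'0 j).
    rewrite (bigD1 d) //= [RHS](bigD1 d) //= (bigD1 c) //= [X in _ = _ + X](bigD1 c) //=.
    rewrite W'd (W'n c) // Wd count_cat /k eqxx eq_sym (negPf cd).
    under eq_bigr => e /andP[ed ec] do rewrite (negPf ec) mul0r subr0 -(W'n e) //.
    by rewrite PoszD mulr0n mulr1n; ring.
  have k'd : k' d = 0 by have := k0 d; rewrite /k eq_sym (negPf cd) mul0r subr0.
  by move=> e; have := k0 e; rewrite /k k'd mulr0 subr0.
have E s : subst_word W s = subst_word W' (subst_word (insert_before c d) s).
  rewrite -subst_word_comp /subst_word; congr flatten; apply: eq_map => e.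
  rewrite /insert_before; case: eqVneq => [->|ed] /=; last by rewrite cats0 W'n.
  by rewrite W'd W'n // cats0.
by move=> s t; rewrite !E => /inj' /(insert_before_inj cd).
Qed.

End Codes.

(** * Leading monomials for an order compatible with products *)

Section LeadingMonomials.

Variables (K : idomainType) (M : monomType) (disp : Order.disp_t).
Variables (T : orderType disp) (key : M -> T).
Hypothesis key_inj : injective key.
Hypothesis keyMl : forall m m1 m2,
  (key m1 < key m2)%O -> (key (mmul m m1) < key (mmul m m2))%O.
Hypothesis keyMr : forall m m1 m2,
  (key m1 < key m2)%O -> (key (mmul m1 m) < key (mmul m2 m))%O.

Definition leading (a : {malg K[M]}) (w : M) : Prop :=
  w \in msupp a /\ forall m, m \in msupp a -> (key m <= key w)%O.

Lemma exists_max_key (S : choiceType) (w : S -> M) (D : {fset S}) s1 :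
  s1 \in D ->
  exists2 s, s \in D & forall t, t \in D -> (key (w t) <= key (w s))%O.
Proof.
move=> s1D; case: (@arg_maxP _ T D (FSetSub s1D) xpredT (fun s => key (w (val s))) isT).
move=> s _ smax; exists (val s); first exact: valP.
by move=> t tD; have := smax (FSetSub tD) isT.
Qed.

Lemma exists_leading a : a != 0 -> exists w, leading a w.
Proof.
rewrite -msupp_eq0 => /fset0Pn [m ma].
by have [w wa wmax] := exists_max_key id ma; exists w.
Qed.

Lemma leading1 : leading 1 mone.
Proof.
split; first by rewrite -mcoeff_neq0 mcoeff1 eqxx oner_eq0.
by move=> m; rewrite -mcoeff_neq0 mcoeff1; case: (m =P mone) => [->|]; rewrite ?lexx ?eqxx.
Qed.

Lemma keyM_le m1 m2 w1 w2 : (key m1 <= key w1)%O -> (key m2 <= key w2)%O ->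
  (key (mmul m1 m2) <= key (mmul w1 w2))%O.
Proof.
rewrite !le_eqVlt => /predU1P[/key_inj ->|lt1] /predU1P[/key_inj ->|lt2].
- by rewrite eqxx.
- by rewrite keyMl ?orbT.
- by rewrite keyMr ?orbT.
- by rewrite (lt_trans (keyMl _ lt2) (keyMr _ lt1)) orbT.
Qed.

Lemma keyM_eq m1 m2 w1 w2 : (key m1 <= key w1)%O -> (key m2 <= key w2)%O ->
  mmul m1 m2 = mmul w1 w2 -> m1 = w1 /\ m2 = w2.
Proof.
rewrite !le_eqVlt => /predU1P[/key_inj ->|lt1] /predU1P[/key_inj ->|lt2] // E.
- by have := keyMl w1 lt2; rewrite E ltxx.
- by have := keyMr w2 lt1; rewrite E ltxx.
- by have := lt_trans (keyMl m1 lt2) (keyMr w2 lt1); rewrite E ltxx.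
Qed.

(** Among pairs from the two supports only [(w1, w2)] has product [mmul w1 w2], whose coefficient is
    thus a product of two nonzero scalars. *)
Lemma leadingM a b w1 w2 :
  leading a w1 -> leading b w2 -> leading (a * b) (mmul w1 w2).
Proof.
move=> [aw1 max1] [bw2 max2]; split; last first.
  by move=> m /msuppM_le [m1 [m2 [/max1 le1 /max2 le2 ->]]]; apply: keyM_le.
rewrite -mcoeff_neq0 mcoeffMl (big_fsetD1 w1) //= (big_fsetD1 w2) //= eqxx mulr1n.
rewrite big_seq big1 => [|m2]; last first.
  rewrite in_fsetD1 => /andP[ne /max2 le2]; case: eqP => // E.
  by case: (keyM_eq (lexx _) le2 E) => _ /eqP; rewrite (negPf ne).
rewrite big_seq big1 => [|m1]; last first.
  rewrite in_fsetD1 => /andP[ne /max1 le1]; rewrite big_seq big1 // => m2 /max2 le2.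
  by case: eqP => // E; case: (keyM_eq le1 le2 E) => /eqP; rewrite (negPf ne).
by rewrite !addr0 mulf_neq0 // mcoeff_neq0.
Qed.

Lemma leading_prod (I : Type) (s : seq I) (F : I -> {malg K[M]}) (w : I -> M) :
  (forall i, leading (F i) (w i)) ->
  leading (\prod_(i <- s) F i) (\big[mmul/mone]_(i <- s) w i).
Proof.
move=> Fw; elim: s => [|i s IH]; first by rewrite !big_nil; apply: leading1.
by rewrite !big_cons; apply: leadingM.
Qed.

(** As [w] is injective, the largest [w s] comes from a single [s] and occurs in no other term, so
    it cannot cancel. *)
Lemma leading_lincomb (S : monomType) (a : {malg K[S]}) (F : S -> {malg K[M]})
    (w : S -> M) :
  injective w -> (forall s, leading (F s) (w s)) -> a != 0 ->
  exists2 m, leading (\sum_(s <- msupp a) a@_s *: F s) m &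
             forall s, s \in msupp a -> (key (w s) <= key m)%O.
Proof.
move=> w_inj Fw; rewrite -msupp_eq0 => /fset0Pn [s1 s1a].
have [s0 s0a s0max] := exists_max_key w s1a.
exists (w s0) => //; split=> [|m].
  rewrite -mcoeff_neq0 raddf_sum (big_fsetD1 s0) //= big_seq big1 => [|s].
    by rewrite addr0 mcoeffZ mulf_neq0 // mcoeff_neq0 //; case: (Fw s0).
  rewrite in_fsetD1 mcoeffZ => /andP[ne sa].
  have [/(Fw s).2 le|/mcoeff_outdom ->] := boolP (w s0 \in msupp (F s)); last first.
    by rewrite mulr0.
  have /key_inj/w_inj E : key (w s0) = key (w s) by apply/le_anti; rewrite le s0max.
  by rewrite E eqxx in ne.
apply: contraTT => lt; rewrite -mcoeff_eq0 raddf_sum big_seq big1 //= => s sa.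
rewrite mcoeffZ (@mcoeff_outdom _ _ (F s)) ?mulr0 //; apply: contra lt => /(Fw s).2 le.
exact: le_trans le (s0max _ sa).
Qed.

End LeadingMonomials.

(** * The weighted order on words *)

Section WordOrder.

Variables (n : nat) (wt : 'I_n -> int).
Implicit Types m : {fmonom 'I_n}.

Definition weight (s : seq 'I_n) : int := \sum_(i <- s) wt i.

(** Length precedes the lexicographic comparison because the latter is compatible with right
    multiplication only between words of equal length. Weights may be negative, so this need not be
    a well-order; maxima are taken over finite supports. *)
Definition word_key m : int *l (nat *l seqlexi 'I_n) :=
  (weight m, (size m, m : seq 'I_n)).

Lemma word_key_inj : injective word_key.
Proof. by move=> m1 m2 [_ _ E]; apply/eqP; rewrite fmP E. Qed.

Lemma ltxi_catl (s s1 s2 : seqlexi 'I_n) :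
  (s ++ s1 < s ++ s2 :> seqlexi 'I_n)%O = (s1 < s2)%O.
Proof. by elim: s => //= i s; rewrite eqhead_ltxiE. Qed.

Lemma ltxi_catr (s1 s2 s : seqlexi 'I_n) : size s1 = size s2 ->
  (s1 ++ s < s2 ++ s :> seqlexi 'I_n)%O = (s1 < s2)%O.
Proof.
elim: s1 s2 => [|i s1 IH] [|j s2] //= -[/IH E].
by rewrite !ltxi_cons E.
Qed.

Lemma word_key_le m1 m2 : (word_key m1 <= word_key m2)%O ->
  weight m1 <= weight m2 /\ (weight m1 = weight m2 -> (size m1 <= size m2)%N).
Proof.
rewrite /word_key lexi_pair => /andP[-> /implyP H]; split=> // E.
by move: H; rewrite E lexx lexi_pair => /(_ isT) /andP[].
Qed.

Lemma word_keyMl m m1 m2 : (word_key m1 < word_key m2)%O ->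
  (word_key (mmul m m1) < word_key (mmul m m2))%O.
Proof.
rewrite /word_key !fmM !size_cat /weight !big_cat /= !ltxi_pair ltxi_catl.
by rewrite !lerD2l !leEnat !leq_add2l.
Qed.

Lemma word_keyMr m m1 m2 : (word_key m1 < word_key m2)%O ->
  (word_key (mmul m1 m) < word_key (mmul m2 m))%O.
Proof.
rewrite /word_key !fmM !size_cat /weight !big_cat /= !ltxi_pair.
rewrite !lerD2r !leEnat !leq_add2r => /andP[-> /implyP H] /=.
apply/implyP => /H {H} /andP[le /implyP H]; rewrite le; apply/implyP => ge.
by rewrite ltxi_catr ?H //; apply/eqP; rewrite eqn_leq le.
Qed.

End WordOrder.

(* Pairs (p, q) stand for fractions p / q, with q = 0 allowed and read as infinity. *)
Lemma exists_min_slope (s : seq (nat * nat)) :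
  has (fun p => 0 < p.2)%N s ->
  exists2 p, p \in s & (0 < p.2)%N /\ forall q, q \in s -> (p.1 * q.2 <= q.1 * p.2)%N.
Proof.
elim: s => //= q s IH; have [/IH [p ps [p2 pmin]] _|nos] := boolP (has _ s).
  have [le|lt] := leqP (p.1 * q.2) (q.1 * p.2).
    exists p; first by rewrite inE ps orbT.
    by split=> // r; rewrite inE => /predU1P[->|/pmin].
  exists q; first by rewrite inE eqxx.
  split; first by nia.
  move=> r; rewrite inE => /predU1P[->//|/pmin le].
  (* Transitivity of the order on fractions through [p], whose denominator is positive and can be
     cancelled. *)
  rewrite -(leq_pmul2r p2); apply: (@leq_trans (p.1 * q.2 * r.2)); nia.
rewrite orbF => q2; exists q; first by rewrite inE eqxx.
split=> // r; rewrite inE => /predU1P[->//|rs].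
have := hasPn nos r rs; lia.
Qed.

(** * Degrees in [x] and [y], and the weights they determine *)

Definition xdeg (m : {fmonom 'I_3}) : nat := count_mem ix m.
Definition ydeg (m : {fmonom 'I_3}) : nat := count_mem iy m.

Lemma ixy : (ix == iy) = false. Proof. by rewrite -val_eqE /= !inordK. Qed.
Lemma ixz : (ix == iz) = false. Proof. by rewrite -val_eqE /= !inordK. Qed.
Lemma iyz : (iy == iz) = false. Proof. by rewrite -val_eqE /= !inordK. Qed.

Lemma letterP (i : 'I_3) : [\/ i = ix, i = iy | i = iz].
Proof.
by case: i => -[|[|[|]]] //= h; [apply: Or31|apply: Or32|apply: Or33];
   apply/val_inj; rewrite /= inordK.
Qed.

Lemma sum_letters (V : nmodType) (F : 'I_3 -> V) : \sum_i F i = F ix + F iy + F iz.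
Proof.
rewrite (bigD1 ix) //= (bigD1 iy) ?(eq_sym iy) ?ixy //= (bigD1 iz) /=; last first.
  by rewrite !(eq_sym iz) ixz iyz.
rewrite big1 ?addr0 ?addrA // => i; rewrite -andbA => /and3P[].
by case: (letterP i) => ->; rewrite eqxx.
Qed.

Lemma dependsP m : depends_on_xy m -> [/\ (0 < xdeg m)%N, (0 < ydeg m)%N & (1 < size m)%N].
Proof.
move=> /andP[]; rewrite -!has_pred1 !has_count => x0 y0; split=> //.
suff : (count_mem ix m + count_mem iy m <= size m)%N by lia.
rewrite -count_predUI -[leqRHS]addn0 leq_add ?count_size //.
rewrite leqn0 -[_ == _]negbK -lt0n -has_count; apply/hasPn => i _ /=.
by case: eqVneq => //= ->; rewrite ixy.
Qed.

Definition wxy (a b : int) (i : 'I_3) : int :=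
  if i == ix then a else if i == iy then b else 0.

Lemma weight_wxy a b (m : {fmonom 'I_3}) :
  weight (wxy a b) m = a * (xdeg m)%:Z + b * (ydeg m)%:Z.
Proof.
rewrite /weight /xdeg /ydeg; elim: (m : seq _) => [|i s IH].
  by rewrite big_nil /= !mulr0.
rewrite big_cons IH /= /wxy !PoszD; case: (letterP i) => ->;
  rewrite ?eqxx ?(eq_sym iz) ?(eq_sym iy ix) ?ixy ?ixz ?iyz /=; ring.
Qed.

Lemma mem_msupp_gen_add (K : fieldType) (p : freeAlg3 K) i (m : {fmonom 'I_3}) :
  (1 < size m)%N -> m \in msupp p -> m \in msupp (gen i + p).
Proof.
move=> m2; rewrite -!mcoeff_neq0 mcoeffD mcoeffU1.
by case: (fmu i =P m) => [E|_]; [rewrite -E fmU in m2 | rewrite add0r].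
Qed.

(** * Images of words under an endomorphism with identity linear part *)

Section TriangularImages.

Variable K : fieldType.
Local Notation A := (freeAlg3 K).
Variables u v : A.
Hypothesis hu : forall m : {fmonom 'I_3}, m \in msupp u -> depends_on_xy m.
Hypothesis hv : forall m : {fmonom 'I_3}, m \in msupp v -> depends_on_xy m.
Local Notation f := (gx + u).
Local Notation g := (gy + v).

Lemma fmu_inj : injective (@fmu 'I_3).
Proof. by move=> i j /eqP; rewrite fmP !fmU => /eqP[]. Qed.

Lemma zimagesE i :
  zimages f g i = gen i + (if i == ix then u else if i == iy then v else 0).
Proof.
rewrite /zimages; case: (letterP i) => ->; rewrite ?eqxx ?(eq_sym iz) ?(eq_sym iy ix) //.
  by rewrite ixy.
by rewrite ixz iyz addr0.
Qed.

Lemma mem_msupp_zimages i m : m \in msupp (zimages f g i) ->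
  m = fmu i \/ depends_on_xy m.
Proof.
rewrite zimagesE => /(fsubsetP (msuppD_le _ _)); rewrite in_fsetU => /orP[].
  by rewrite msuppU1 in_fset1 => /eqP; left.
by case: ifP => _ => [/hu|]; [right|case: ifP => _ => [/hv|]; [right|rewrite msupp0]].
Qed.

Lemma zimages_x : zimages f g ix = f.
Proof. by rewrite /zimages eqxx. Qed.

Lemma zimages_y : zimages f g iy = g.
Proof. by rewrite /zimages eqxx eq_sym ixy. Qed.

Lemma mcoeff_zimages_fmu i j : (zimages f g i)@_(fmu j) = (i == j)%:R.
Proof.
rewrite zimagesE mcoeffD mcoeffU1 (inj_eq fmu_inj) [X in _ + X]mcoeff_outdom ?addr0 //.
apply/negP; have nodep : ~~ depends_on_xy (fmu j).
  by apply/negP => /dependsP[_ _]; rewrite fmU.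
by case: ifP => _ => [/hu|]; [|case: ifP => _ => [/hv|]; [|rewrite msupp0]];
  rewrite ?(negPf nodep).
Qed.

(** No image of a letter has a constant term, so each letter contributes at least one letter. *)
Lemma size_msupp_zword s m : m \in msupp (zword f g s) -> (size s <= size m)%N.
Proof.
rewrite /zword; elim: (s : seq _) m => [|i t IH] m //; rewrite big_cons.
move=> /msuppM_le [m1 [m2 [m1f /IH le ->]]]; rewrite fmM size_cat /=.
rewrite -add1n leq_add //.
by case: (mem_msupp_zimages m1f) => [->|/dependsP[_ _ /ltnW]] //; rewrite fmU.
Qed.

Lemma mcoeff_zword_fmu s i : (zword f g s)@_(fmu i) = (s == fmu i)%:R.
Proof.
have [lt|] := leqP 2 (size s).
  rewrite mcoeff_outdom; last first.
    by apply/negP => /size_msupp_zword; rewrite fmU leqNgt lt.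
  by case: eqP => // E; rewrite E fmU in lt.
rewrite fmP fmU /zword; case: (s : seq _) => [|j [|]] //= _.
  by rewrite big_nil mcoeff1 -fdeg_eq0 fdegU.
by rewrite big_seq1 mcoeff_zimages_fmu eqseq_cons eqxx andbT.
Qed.

(** Words of length other than one contribute nothing to one-letter coefficients. *)
Lemma mcoeff_zendo_fmu (a : A) i : (zendo f g a)@_(fmu i) = a@_(fmu i).
Proof.
rewrite /zendo mmapE raddf_sum /=.
under eq_bigr => s _ do rewrite mcoeffCM mcoeff_zword_fmu.
have [ai|/[dup] ai /mcoeff_outdom ->] := boolP (fmu i \in msupp a).
  rewrite (big_fsetD1 (fmu i)) //= eqxx mulr1 big_seq big1 ?addr0 // => s.
  by rewrite in_fsetD1 => /andP[/negPf-> _]; rewrite mulr0.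
rewrite big_seq big1 // => s sa; case: eqP => [E|]; last by rewrite mulr0.
by rewrite -E sa in ai.
Qed.

Lemma leading_zimages_preimage (a b : int) (w : 'I_3 -> {fmonom 'I_3}) (i : 'I_3) (p : A) :
  (forall j, leading (word_key (wxy a b)) (zimages f g j) (w j)) ->
  injective (subst_word (fun j => w j : seq 'I_3)) ->
  zendo f g p = gen i -> w i = fmu i.
Proof.
move=> lead_w code pE.
pose key := word_key (wxy a b).
have wkey_inj := @word_key_inj _ (wxy a b).
have wkeyMl := @word_keyMl _ (wxy a b).
have wkeyMr := @word_keyMr _ (wxy a b).
pose W (s : {fmonom 'I_3}) := \big[mmul/mone]_(j <- s) w j.
have WE s : W s = subst_word (fun j => w j : seq 'I_3) s :> seq 'I_3.
  rewrite /W; elim: (s : seq _) => [|j t IH]; first by rewrite big_nil fm1.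
  by rewrite big_cons fmM IH.
have W_inj : injective W.
  by move=> s t E; apply/eqP; rewrite fmP; apply/eqP/code; rewrite -!WE E.
have ip : fmu i \in msupp p.
  by rewrite -mcoeff_neq0 -mcoeff_zendo_fmu pE mcoeffUU oner_eq0.
have p0 : p != 0 by rewrite -msupp_eq0; apply/fset0Pn; exists (fmu i).
have lead_s s : leading key (zword f g s) (W s) by apply: leading_prod.
have [m [mp _] mmax] := leading_lincomb wkey_inj W_inj lead_s p0.
have {mp} mE : m = fmu i.
  apply/eqP; rewrite -in_fset1 -(@msuppU1 _ K) -/(gen i) -pE /zendo mmapE.
  by move: mp; congr (_ \in msupp _); apply: eq_bigr => s _; rewrite mul_malgC.
(* [w i] is at most the leading word [fmu i] of the image of [p], because [fmu i] lies in the
   support of [p]; conversely [fmu i] occurs in [zimages f g i]. *)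
apply: wkey_inj; apply: le_anti; apply/andP; split.
  by have := mmax _ ip; rewrite mE /W fmU big_seq1.
by apply: (lead_w i).2; rewrite -mcoeff_neq0 mcoeff_zimages_fmu eqxx oner_eq0.
Qed.

End TriangularImages.

(** * Choice of the weights *)

(** The sign condition serves to prove that the degree vectors of the leading words are independent;
    the tie in the last clause yields the final contradiction. *)
Lemma exists_weights (K : fieldType) (u v : freeAlg3 K) :
  (u, v) <> (0, 0) ->
  (forall m : {fmonom 'I_3}, m \in msupp u -> depends_on_xy m) ->
  (forall m : {fmonom 'I_3}, m \in msupp v -> depends_on_xy m) ->
  exists a b : int,
   [/\ (a < 0 /\ 0 <= b) \/ (b < 0 /\ 0 <= a),
       forall m, m \in msupp u -> weight (wxy a b) m <= a,
       forall m, m \in msupp v -> weight (wxy a b) m <= b &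
       (exists2 m, m \in msupp u & weight (wxy a b) m = a) \/
       (exists2 m, m \in msupp v & weight (wxy a b) m = b)].
Proof.
move=> uv hu hv.
(* For (a, b) = (p, -q) with q > 0, a word of [u] (of [v]) has weight at most
   [a] (at most [b]) iff p / q is at most the fraction listed here. *)
pose su := [seq (ydeg m, (xdeg m).-1) | m <- msupp u].
pose sv := [seq ((ydeg m).-1, xdeg m) | m <- msupp v].
have [hs|nohas] := boolP (has (fun p => 0 < p.2)%N (su ++ sv)).
  have [p ps [p2 pmin]] := exists_min_slope hs.
  (* Minimality of the fraction [p] gives the two bounds, and the word it comes from gives the
     tie. *)
  exists p.1%:Z, (- p.2%:Z); split.
  - by right; lia.
  - move=> m mu; have [x0 y0 _] := dependsP (hu m mu); rewrite weight_wxy.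
    have : (ydeg m, (xdeg m).-1) \in su ++ sv by rewrite mem_cat map_f.
    by move/pmin => /=; nia.
  - move=> m mv; have [x0 y0 _] := dependsP (hv m mv); rewrite weight_wxy.
    have : ((ydeg m).-1, xdeg m) \in su ++ sv by rewrite mem_cat map_f ?orbT.
    by move/pmin => /=; nia.
  - move: ps; rewrite mem_cat => /orP[] /mapP[m mS ->] /=; [left|right];
      exists m => //; rewrite weight_wxy.
    + have [x0 y0 _] := dependsP (hu m mS); nia.
    + have [x0 y0 _] := dependsP (hv m mS); nia.
(* All fractions are infinite here: a word of [v] would give a finite one, and the words of [u] have
   degree 1 in [x], so weights [(-1, 0)] make them all tie with [x]. *)
have v0 : v = 0.
  apply/eqP; rewrite -msupp_eq0; apply/fset0Pn => -[m mv].
  have [x0 _ _] := dependsP (hv m mv); move/hasPn: nohas => /(_ ((ydeg m).-1, xdeg m)).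
  by rewrite mem_cat map_f // orbT x0 => /(_ isT).
have /fset0Pn [m mu] : msupp u != fset0.
  by rewrite msupp_eq0; apply/eqP => u0; apply: uv; rewrite u0 v0.
have x1 m' : m' \in msupp u -> xdeg m' = 1%N.
  move=> mu'; have [x0 _ _] := dependsP (hu m' mu'); move/hasPn: nohas.
  by move=> /(_ (ydeg m', (xdeg m').-1)); rewrite mem_cat map_f //= => /(_ isT); lia.
exists (-1), 0; split=> [|m' mu'|m'|].
- by left.
- by rewrite weight_wxy x1.
- by rewrite v0 msupp0.
- by left; exists m => //; rewrite weight_wxy x1.
Qed.

Theorem theorem3p4 (K : fieldType) (u v : freeAlg3 K)
  (huv : (u, v) <> (0, 0))
  (hu : forall m : {fmonom 'I_3}, m \in msupp u -> depends_on_xy m)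
  (hv : forall m : {fmonom 'I_3}, m \in msupp v -> depends_on_xy m) :
  ~ is_automorphism (zendo (gx + u) (gy + v)).
Proof.
move=> [psi _ psiK].
have [a [b [ab ua vb eq_ab]]] := exists_weights huv hu hv.
pose f := gx + u; pose g := gy + v.
pose key := word_key (wxy a b).
have /fin_all_exists [w lead_w] i : exists w, leading key (zimages f g i) w.
  apply: exists_leading; apply/eqP => E; have := mcoeff_zimages_fmu hu hv i i.
  by rewrite E mcoeff0 eqxx => /eqP; rewrite eq_sym oner_eq0.
have wz : w iz = fmu iz.
  have [] := lead_w iz; rewrite /zimages !(eq_sym iz) ixz iyz.
  by rewrite msuppU1 in_fset1 => /eqP.
have wtx : weight (wxy a b) (fmu ix) = a.
  by rewrite /weight fmU big_seq1 /wxy eqxx.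
have wty : weight (wxy a b) (fmu iy) = b.
  by rewrite /weight fmU big_seq1 /wxy eqxx eq_sym ixy.
have in_f : fmu ix \in msupp (zimages f g ix).
  by rewrite -mcoeff_neq0 (mcoeff_zimages_fmu hu hv) eqxx oner_eq0.
have in_g : fmu iy \in msupp (zimages f g iy).
  by rewrite -mcoeff_neq0 (mcoeff_zimages_fmu hu hv) eqxx oner_eq0.
(* The leading word weighs at least [a] since [x] occurs in [f], and at most [a] by the choice of
   weights. *)
have [wx_a wx_x] : weight (wxy a b) (w ix) = a /\ (0 < xdeg (w ix))%N.
  have [+ /(_ _ in_f)/word_key_le[+ _]] := lead_w ix; rewrite wtx zimages_x.
  move=> /(fsubsetP (msuppD_le _ _)); rewrite in_fsetU msuppU1 in_fset1.
  case/predU1P => [-> _|wu le]; first by rewrite wtx /xdeg fmU /= eqxx.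
  have [x0 _ _] := dependsP (hu _ wu); split=> //.
  by apply: le_anti; rewrite le ua.
have [wy_b wy_y] : weight (wxy a b) (w iy) = b /\ (0 < ydeg (w iy))%N.
  have [+ /(_ _ in_g)/word_key_le[+ _]] := lead_w iy; rewrite wty zimages_y.
  move=> /(fsubsetP (msuppD_le _ _)); rewrite in_fsetU msuppU1 in_fset1.
  case/predU1P => [-> _|wv le]; first by rewrite wty /ydeg fmU /= eqxx.
  have [_ y0 _] := dependsP (hv _ wv); split=> //.
  by apply: le_anti; rewrite le vb.
have code : injective (subst_word (fun j => w j : seq 'I_3)).
  apply: independent_code => k k0.
  (* With [D] this determinant, the weight equations give [a * D = a * ydeg (w iy) - b * ydeg (w
     ix)] and [b * D = b * xdeg (w ix) - a * xdeg (w iy)]. By the sign condition the first right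
     side is negative if [a < 0], the second if [b < 0]. *)
  have det_neq0 : (xdeg (w ix))%:Z * (ydeg (w iy))%:Z
      - (xdeg (w iy))%:Z * (ydeg (w ix))%:Z != 0.
    move: wx_a wy_b; rewrite !weight_wxy => wx_a wy_b; nia.
  have := k0 ix; have := k0 iy; have := k0 iz; rewrite !sum_letters wz fmU /=.
  rewrite !(eq_sym iz) ixz iyz eqxx -!/(xdeg _) -!/(ydeg _) => kz ky kx.
  (* Cramer's rule on the [x] and [y] counts, to which [w iz] contributes nothing; the [z] count
     then determines [k iz]. *)
  have kx0 : k ix = 0 by apply: (mulIf det_neq0); rewrite mul0r; nia.
  have ky0 : k iy = 0 by apply: (mulIf det_neq0); rewrite mul0r; nia.
  have kz0 : k iz = 0 by move: kz; rewrite kx0 ky0; lia.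
  by move=> c; case: (letterP c) => ->.
have wx : w ix = fmu ix := leading_zimages_preimage hu hv lead_w code (psiK _).
have wy : w iy = fmu iy := leading_zimages_preimage hu hv lead_w code (psiK _).
(* The tying word has length at least 2, so it exceeds the letter of the same weight, which was just
   shown to be leading. *)
case: eq_ab => [[m mu wm]|[m mv wm]].
- have [_ _ m2] := dependsP (hu m mu).
  have [_ /(_ m)] := lead_w ix; rewrite wx zimages_x.
  move=> /(_ (mem_msupp_gen_add _ m2 mu))/word_key_le[_].
  by rewrite wtx wm fmU leqNgt m2 => /(_ erefl).
- have [_ _ m2] := dependsP (hv m mv).
  have [_ /(_ m)] := lead_w iy; rewrite wy zimages_y.
  move=> /(_ (mem_msupp_gen_add _ m2 mv))/word_key_le[_].
  by rewrite wty wm fmU leqNgt m2 => /(_ erefl).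
Qed.
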